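(* Let $A,B\in\mathcal{L}(\mathcal{H})$ be Hermitian operators with closed ranges. Then ($A\leq B$ and $A\overset{*}{\leq}B$) if and only if ($A^\dagger\leq B^\dagger$ and $A^\dagger\overset{*}{\leq}B^\dagger$).
   Context: $\mathcal{H}$ is a complex Hilbert space and $\mathcal{L}(\mathcal{H})$ is the algebra of bounded linear operators on $\mathcal{H}$. $\leq$ is the L\''owner order on Hermitian operators: $A\leq B$ if and only if $B-A$ is positive semidefinite. Star order: for $A,B\in\mathcal{L}(\mathcal{H})$, $A\overset{*}{\leq}B$ if $A^*A=A^*B$ and $AA^*=BA^*$. For $T\in\mathcal{L}(\mathcal{H})$ with closed range, $T^\dagger\in\mathcal{L}(\mathcal{H})$ is the Moore-Penrose inverse, i.e. the unique $X$ with $TXT=T$, $XTX=X$, $(TX)^*=TX$, $(XT)^*=XT$. *)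

(* Defs.v *)
From HB Require Import structures.
From mathcomp Require Import all_boot all_order all_algebra.
From mathcomp Require Import complex.
From mathcomp Require Import all_classical all_reals all_analysis.

Set Implicit Arguments.
Unset Strict Implicit.
Unset Printing Implicit Defensive.

Import Order.TTheory GRing.Theory Num.Theory.
Import numFieldNormedType.Exports.

Local Open Scope classical_set_scope.
Local Open Scope ring_scope.

(* The scalar field is R[i], so norms are (real, nonnegative) elements of R[i].
   The inner product is linear in its first argument. *)
HB.mixin Record CompleteNormedModule_isHilbert (R : realType) H
    & CompleteNormedModule R[i] H := {
  inner : {dot H for (@Num.conj R[i])} ;
  inner_norm : forall x : H, inner x x = `|x| ^+ 2
}.

#[short(type="hilbertType")]
HB.structure Definition Hilbert (R : realType) :=
  {H of CompleteNormedModule R[i] H & CompleteNormedModule_isHilbert R H}.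

Section BoundedOperators.
Context {R : realType} {H : hilbertType R}.

Definition bounded_linear (f : H -> H) :=
  exists M : R[i], forall x, `|f x| <= M * `|x|.

Record bop := Bop {
  bop_fun :> {linear H -> H} ;
  bop_bounded : bounded_linear bop_fun
}.

HB.instance Definition _ := gen_eqMixin bop.
HB.instance Definition _ := gen_choiceMixin bop.

Lemma bopP (A B : bop) : A =1 B -> A = B.
Proof.
move=> AB; have ABf : bop_fun A = bop_fun B.
  case: A B AB => [[f [[mf] [sf]]] bf] [[g [[mg] [sg]]] bg] /= /funext fg.
  subst g; congr GRing.Linear.Pack.
  by congr GRing.Linear.Class; congr (_ _); exact: Prop_irrelevance.
case: A B ABf {AB} => [f bf] [g bg] /= fg; subst g.
by congr Bop; exact: Prop_irrelevance.
Qed.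

Fact bop0_bounded : bounded_linear (\0 : {linear H -> H}).
Proof. by exists 0 => x; rewrite normr0 mul0r. Qed.

Definition bop0 := Bop bop0_bounded.

Fact sub_bop_bounded (A B : bop) :
  bounded_linear (A \- B : {linear H -> H}).
Proof.
have [[M AM] [N BN]] := (bop_bounded A, bop_bounded B).
exists (M + N) => x; rewrite mulrDl.
by apply: le_trans (ler_normB _ _) _; exact: lerD.
Qed.

Definition sub_bop (A B : bop) := Bop (sub_bop_bounded A B).

Fact comp_bop_bounded (A B : bop) :
  bounded_linear (A \o B : {linear H -> H}).
Proof.
have [[M AM] [N BN]] := (bop_bounded A, bop_bounded B).
exists (`|M| * N) => x /=; apply: le_trans (AM _) _.
have [->|Bx0] := eqVneq (B x) 0.
  rewrite normr0 mulr0 -mulrA mulr_ge0 //.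
  exact: le_trans (normr_ge0 _) (BN _).
have BxP : 0 < `|B x| by rewrite normr_gt0.
have M0 : 0 <= M.
  by rewrite -(pmulr_lge0 _ BxP); exact: le_trans (normr_ge0 _) (AM _).
by rewrite ger0_norm // -mulrA; apply: ler_wpM2l.
Qed.

Definition comp_bop (A B : bop) := Bop (comp_bop_bounded A B).

Definition is_adjoint (T S : bop) := forall x y, inner (T x) y = inner x (S y).

(* The adjoint always exists, by the Riesz representation theorem, so the
   default value [bop0] is never used. *)
Definition adjoint (T : bop) : bop := xget bop0 [set S | is_adjoint T S].

Lemma is_adjoint_uniq (T S S' : bop) :
  is_adjoint T S -> is_adjoint T S' -> S = S'.
Proof.
move=> TS TS'; apply: bopP => y; apply/eqP; rewrite -subr_eq0.
apply: contraT => /neq0_dnorm_gt0 => /(_ _ inner).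
by rewrite linearBr /= -TS -TS' subrr ltxx.
Qed.

Definition hermitian_op (T : bop) := adjoint T = T.

(* The order of R[i] makes [0 <= z] mean that z is real and nonnegative. *)
Definition positive_semidefinite (T : bop) := forall x : H, 0 <= inner (T x) x.

Definition loewner_le (A B : bop) := positive_semidefinite (sub_bop B A).

Definition star_le (A B : bop) :=
  comp_bop (adjoint A) A = comp_bop (adjoint A) B /\
  comp_bop A (adjoint A) = comp_bop B (adjoint A).

Definition closed_range (T : bop) := closed (range T).

Definition is_moore_penrose (T X : bop) :=
  [/\ comp_bop (comp_bop T X) T = T,
      comp_bop (comp_bop X T) X = X,
      adjoint (comp_bop T X) = comp_bop T X
    & adjoint (comp_bop X T) = comp_bop X T].

(* Meaningful when T has closed range, which is equivalent to the existence of
   a bounded Moore-Penrose inverse; [bop0] otherwise. *)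
Definition moore_penrose (T : bop) : bop :=
  xget bop0 [set X | is_moore_penrose T X].

End BoundedOperators.

Arguments bop {R} H.

(* Main.v *)
From HB Require Import structures.
Require Import Defs.
From mathcomp Require Import all_boot all_order all_algebra.
From mathcomp Require Import complex.
From mathcomp Require Import all_classical all_reals all_analysis.
From mathcomp Require Import ring lra.

(** Star order plus Löwner order pass to the Moore-Penrose inverses by pure
algebra, and they come back because [A] is in turn the Moore-Penrose inverse of
its inverse.  Write [X] and [Y] for the inverses of the self-adjoint operators
[A] and [B].  The star order says [A A = A B = B A], that is, [B] splits as [A]
on the range of [A] and some other operator on the orthogonal complement.
Inverting each block gives [X X = X Y = Y X], which is the star order between
[X] and [Y], and also [Y A Y = X].  As [Y B Y = Y], this yields
[Y - X = Y (B - A) Y], a congruence of [B - A] by the self-adjoint [Y], so it is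
positive semidefinite as soon as [B - A] is ([orders_moore_penrose]).

The analytic content is that a self-adjoint operator [A] with closed range has
a bounded, self-adjoint Moore-Penrose inverse ([moore_penrose_exists]).
Orthogonal projection onto the closed range ([orthogonal_projection]) provides,
for every [y], some [x] in the range of [A] such that [A x] is the projection of
[y]; this [x] is the value of the inverse at [y].  The resulting function is
symmetric for the inner product, and by the Hellinger-Toeplitz theorem a
symmetric function defined on the whole space is linear and bounded
([symmetric_bop]).

Norms take their values in [R[i]], whose order is partial.  All estimates are
therefore made in [R], on the real parts of norms and inner products. *)

Set Implicit Arguments.
Unset Strict Implicit.
Unset Printing Implicit Defensive.

Import Order.TTheory GRing.Theory Num.Theory.
Import numFieldNormedType.Exports.

Local Open Scope classical_set_scope.
Local Open Scope ring_scope.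

(** * The underlying real inner product *)

Section RealGeometry.
Context {R : realType} {H : hilbertType R}.
Implicit Types (x y z : H) (t : R).

Definition rdot x y : R := complex.Re (inner x y).
Definition nrm x : R := complex.Re `|x|.

Lemma nrmE x : `|x| = (nrm x)%:C%C.
Proof. by rewrite RRe_real ?normr_real. Qed.

Lemma inner_inj x y : (forall z, inner x z = inner y z) -> x = y.
Proof.
move=> xy; apply/eqP; rewrite -subr_eq0.
apply: contraT => /neq0_dnorm_gt0 => /(_ _ inner).
by rewrite linearBl /= xy subrr ltxx.
Qed.

Lemma innerC x y : inner x y = Num.conj (inner y x).
Proof. by rewrite hermC /= expr0 mul1r. Qed.

Lemma rdotC x y : rdot x y = rdot y x.
Proof. by rewrite /rdot innerC; case: (inner y x). Qed.

Lemma rdotDl x y z : rdot (x + y) z = rdot x z + rdot y z.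
Proof.
by rewrite /rdot linearDl /=; case: (inner x z) (inner y z) => ? ? [].
Qed.

Lemma rdot0 z : rdot 0 z = 0.
Proof. by have := rdotDl 0 0 z; rewrite addr0; lra. Qed.

Lemma rdotNl x z : rdot (- x) z = - rdot x z.
Proof. by rewrite /rdot linearNl /=; case: (inner x z). Qed.

Lemma rdotZl t x z : rdot (t%:C%C *: x) z = t * rdot x z.
Proof.
rewrite /rdot linearZl_LR /=; case: (inner x z) => a b /=.
by rewrite mul0r subr0.
Qed.

Lemma rdotDr x y z : rdot z (x + y) = rdot z x + rdot z y.
Proof. by rewrite rdotC rdotDl !(rdotC _ z). Qed.

Lemma rdotNr x z : rdot z (- x) = - rdot z x.
Proof. by rewrite rdotC rdotNl rdotC. Qed.

Lemma rdotZr t x z : rdot z (t%:C%C *: x) = t * rdot z x.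
Proof. by rewrite rdotC rdotZl rdotC. Qed.

Lemma rdotxx x : rdot x x = nrm x ^+ 2.
Proof. by rewrite /rdot inner_norm nrmE -rmorphXn. Qed.

Lemma nrm_ge0 x : 0 <= nrm x.
Proof. by rewrite -ler0c -nrmE. Qed.

Lemma nrm0 : nrm (0 : H) = 0.
Proof. by rewrite /nrm normr0. Qed.

Lemma nrm_eq0 x : (nrm x == 0) = (x == 0).
Proof. by rewrite -(normr_eq0 x) nrmE eq_complex /= eqxx andbT. Qed.

Lemma nrm_gt0 x : (0 < nrm x) = (x != 0).
Proof. by rewrite lt_neqAle nrm_ge0 andbT eq_sym nrm_eq0. Qed.

Lemma nrmN x : nrm (- x) = nrm x.
Proof. by rewrite /nrm normrN. Qed.

Lemma nrmD x y : nrm (x + y) <= nrm x + nrm y.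
Proof. by rewrite -lecR rmorphD /= -!nrmE ler_normD. Qed.

Lemma nrmZ t x : nrm (t%:C%C *: x) = `|t| * nrm x.
Proof.
apply: complexI; rewrite rmorphM /= -!nrmE normrZ normc_def /=.
by rewrite expr0n addr0 sqrtr_sqr.
Qed.

Lemma nrm_subE x t y :
  nrm (x - t%:C%C *: y) ^+ 2 =
    nrm x ^+ 2 - 2 * t * rdot x y + t ^+ 2 * nrm y ^+ 2.
Proof.
rewrite -!rdotxx !(rdotDl, rdotDr, rdotNl, rdotNr, rdotZl, rdotZr).
by rewrite (rdotC y x); ring.
Qed.

(** Cauchy-Schwarz: the squared norm of [x - t y] is nonnegative, and the choice
[t = nrm x / nrm y] makes this inequality the desired one. *)
Lemma rdot_le x y : rdot x y <= nrm x * nrm y.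
Proof.
have [->|y0] := eqVneq y 0.
  by rewrite nrm0 mulr0 rdotC rdot0.
have y1 : 0 < nrm y by rewrite nrm_gt0.
have [->|x0] := eqVneq x 0.
  by rewrite nrm0 mul0r rdot0.
have x1 : 0 < nrm x by rewrite nrm_gt0.
have := sqr_ge0 (nrm (x - (nrm x / nrm y)%:C%C *: y)).
rewrite nrm_subE expr_div_n divfK ?sqrf_eq0 ?gt_eqF// => h.
rewrite -(ler_pM2l (divr_gt0 x1 y1)).
have -> : nrm x / nrm y * (nrm x * nrm y) = nrm x ^+ 2.
  by field; rewrite nrm_eq0.
by lra.
Qed.

Lemma abs_rdot_le x y : `|rdot x y| <= nrm x * nrm y.
Proof. by rewrite ler_norml lerNl -rdotNl -{1}(nrmN x) !rdot_le. Qed.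

End RealGeometry.

(** * Completeness and orthogonal projection *)

Section Complete.
Context {R : realType} {H : hilbertType R}.
Implicit Types (u : nat -> H) (e : nat -> R).

(** The rate [e] survives in the limit because the norm is continuous; stating
this rate, and the closed sets that contain the limit, reduces all later limit
arguments to estimates in [R]. *)
Lemma cauchy_rate u e : e n @[n --> \oo] --> 0 ->
  (forall n m, (n <= m)%N -> nrm (u m - u n) <= e n) ->
  exists2 l : H, (forall n, nrm (l - u n) <= e n) &
    (forall C : set H, closed C -> (forall n, C (u n)) -> C l).
Proof.
move=> e0 ue.
have /cvg_ex[l ul] : cvg (u n @[n --> \oo]).
  apply: cauchy_cvg; apply: cauchy_exP => eps eps0.
  have eps0' : 0 < complex.Re eps by move: eps0; rewrite ltcE => /andP[].
  have /cvgrPdist_lt/(_ _ eps0')[N _ /(_ N (leqnn N)) eN] := e0.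
  exists (u N); exists N => // m /= Nm; rewrite -ball_normE /=.
  rewrite -[eps]RRe_real ?gtr0_real// nrmE ltcR -nrmN opprB.
  apply: le_lt_trans (ue _ _ Nm) _; apply: le_lt_trans eN.
  by rewrite sub0r normrN ler_norm.
exists l => [n|C clC uC]; last first.
  by apply: (closed_cvg _ clC) ul; exact: nearW.
apply/ler_addgt0Pr => d d0.
have dc : 0 < d%:C%C :> R[i] by rewrite ltcR.
have /cvgrPdist_lt/(_ _ dc)[N _ uN] := ul.
pose m := maxn N n.
have := uN m (leq_maxl _ _); rewrite nrmE ltcR => lm.
have -> : l - u n = (u m - u n) + (l - u m) by rewrite [RHS]addrC subrKA.
apply: le_trans (nrmD _ _) _; apply: lerD (ltW lm).
exact/ue/leq_maxr.
Qed.

End Complete.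

Lemma natmul_bounded_le0 (R : archiRealFieldType) (r k : R) :
  (forall n : nat, r * n%:R <= k) -> r <= 0.
Proof.
move=> rk; rewrite leNgt; apply/negP => r0.
have := rk (Num.truncn (k / r)).+1.
by rewrite leNgt mulrC -ltr_pdivrMr// truncnS_gt.
Qed.

Section Projection.
Context {R : realType} {H : hilbertType R}.

(** The projection of [y] is the limit of a sequence [u] minimizing the distance
to [C].  If [u n] is optimal up to [h n ^+ 2] for the squared distance, then
moving it in the direction [m] of [C] cannot gain more than that; this bounds
the inner product of [y - u n] with [m] by [h n * nrm m].  This almost
orthogonality alone gives both the Cauchy property (take for [m] the difference
of two terms) and the orthogonality of the limit. *)
Lemma orthogonal_projection (C : set H) : closed C -> C 0 ->
    (forall c x y, C x -> C y -> C (c *: x + y)) ->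
  forall y, exists2 p, C p & forall m, C m -> inner (y - p) m = 0.
Proof.
move=> clC C0 linC y.
have CN x : C x -> C (- x).
  by move=> Cx; have := linC (-1) _ _ Cx C0; rewrite scaleN1r addr0.
have CB x z : C x -> C z -> C (x - z).
  by move=> Cx Cz; have := linC 1 _ _ Cx (CN _ Cz); rewrite scale1r.
pose D := [set nrm (y - m) ^+ 2 | m in C].
have infD : has_inf D.
  split; first by exists (nrm (y - 0) ^+ 2), 0.
  by exists 0 => _ [m _ <-]; exact: sqr_ge0.
pose h n : R := n.+1%:R^-1.
have h0 n : 0 < h n by rewrite invr_gt0.
have hle n m : (n <= m)%N -> h m <= h n.
  by move=> nm; rewrite lef_pV2 ?posrE// ler_nat.
have /choice[u uP] n : exists m, C m /\ nrm (y - m) ^+ 2 < inf D + h n ^+ 2.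
  have [_ [m Cm <-] ?] := inf_adherent (exprn_gt0 2 (h0 n)) infD.
  by exists m.
have uC n : C (u n) by case: (uP n).
have almost_orth n m : C m -> rdot (y - u n) m <= h n * nrm m.
  move=> Cm; have [->|m0] := eqVneq m 0.
    by rewrite rdotC rdot0 nrm0 mulr0.
  have N0 : 0 < nrm m by rewrite nrm_gt0.
  (* The step that balances [h n ^+ 2] and [t ^+ 2 * nrm m ^+ 2]. *)
  pose t := h n / nrm m.
  have : inf D <= nrm (y - u n - t%:C%C *: m) ^+ 2.
    apply: ge_inf; first exact: infD.2.
    exists (t%:C%C *: m + u n); first exact: linC.
    by rewrite opprD addrA addrAC.
  have t0 : 0 < t by rewrite divr_gt0.
  rewrite nrm_subE -exprMn divfK ?gt_eqF//.
  have := (uP n).2 => ? ?.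
  have trdot : t * rdot (y - u n) m <= h n ^+ 2 by lra.
  rewrite -(ler_pM2l t0); apply: le_trans trdot _.
  by rewrite mulrCA divfK ?gt_eqF// expr2.
have e0 : 2 * h n @[n --> \oo] --> 0.
  by rewrite -(mulr0 2); apply: cvgM; [exact: cvg_cst | exact: cvg_harmonic].
have ue n m : (n <= m)%N -> nrm (u m - u n) <= 2 * h n.
  move=> nm; set v := u m - u n.
  have [->|v0] := eqVneq v 0; first by rewrite nrm0 mulr_ge0// ltW.
  have Cv : C v by exact: CB.
  have := almost_orth n _ Cv; have := almost_orth m _ (CN _ Cv).
  have := rdotxx v; rewrite rdotNr nrmN.
  have -> : rdot v v = rdot (y - u n) v - rdot (y - u m) v.
    by rewrite -rdotNl -rdotDl opprB addrC subrKA.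
  have vp : 0 < nrm v by rewrite nrm_gt0.
  have := hle _ _ nm.
  rewrite -(ler_pM2r vp) => ? ? ? ?.
  rewrite -(ler_pM2r vp); lra.
have [p up /(_ C clC uC) Cp] := cauchy_rate e0 ue.
exists p => // m Cm.
have re_le0 z : C z -> rdot (y - p) z <= 0.
  move=> Cz; apply: (@natmul_bounded_le0 _ _ (3 * nrm z)) => -[|n].
    by rewrite mulr0 mulr_ge0// nrm_ge0.
  have -> : y - p = (y - u n) + (u n - p) by rewrite subrKA.
  rewrite -ler_pdivlMr// rdotDl -/(h n).
  have := almost_orth n _ Cz; have := rdot_le (u n - p) z.
  have : nrm (u n - p) * nrm z <= 2 * h n * nrm z.
    by apply: ler_wpM2r; [exact: nrm_ge0 | rewrite -nrmN opprB].
  lra.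
(* Rotating [m] by the phase of the inner product turns a bound on the real part
   into a bound on the modulus. *)
have Cm' : C (inner (y - p) m *: m) by rewrite -[_ *: _]addr0; exact: linC.
have := re_le0 _ Cm'.
rewrite /rdot linearZr_LR /= mulrC -normCK.
set c := inner _ _; rewrite -add_Re2_Im2 /= => c0.
have [] : complex.Re c ^+ 2 = 0 /\ complex.Im c ^+ 2 = 0.
  by have := sqr_ge0 (complex.Re c); have := sqr_ge0 (complex.Im c); lra.
move=> /eqP + /eqP; rewrite !sqrf_eq0 => re0 im0.
by apply/eqP; rewrite eq_complex re0.
Qed.

End Projection.

(** * The Hellinger-Toeplitz theorem *)

Section HellingerToeplitz.
Context {R : realType} {H : hilbertType R}.
Variable f : H -> H.
Hypothesis f_sym : forall x y, inner (f x) y = inner x (f y).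

(** The inner product separates points, and on the other side of it [f] no
longer meets the linear combination. *)
Lemma symmetric_linear : linear f.
Proof.
move=> a x y; apply: inner_inj => z.
by rewrite f_sym !linearDl !linearZl_LR /= !f_sym.
Qed.

(** A gliding hump argument.  If [f] is unbounded, there are vectors [y n] on
which [f] is arbitrarily large compared with [nrm (y n)].  The sequence [u]
takes a step of length [3^-1 ^+ n.+1] along [f (y n)], with the sign that makes
its inner product with [f (y n)] grow.  Since the later steps together are at
most half as long as this one, they cannot undo the gain: the limit [x]
satisfies [rdot x (f (y n)) >= 2^-1 * 3^-1 ^+ n.+1 * nrm (f (y n))] in absolute
value.  But this quantity is also [rdot (f x) (y n)], at most
[nrm (f x) * nrm (y n)], so that [nrm (f x)] is at least every natural
number [n]. *)
Lemma symmetric_bounded : exists M : R, forall x, nrm (f x) <= M * nrm x.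
Proof.
apply: contrapT => unbounded.
pose w n : R := 3^-1 ^+ n.
have w0 n : 0 < w n by rewrite exprn_gt0// invr_gt0.
have wS n : w n.+1 = 3^-1 * w n by rewrite /w exprS.
have /choice[y yP] n : exists y, n%:R * nrm y < nrm (f y) * (2^-1 * w n.+1).
  apply: contrapT => nex; apply: unbounded.
  exists (n%:R / (2^-1 * w n.+1)) => x.
  rewrite mulrAC ler_pdivlMr ?mulr_gt0// leNgt; apply/negP => xP.
  by apply: nex; exists x.
have fy0 n : 0 < nrm (f (y n)).
  have := yP n; have := mulr_ge0 (ler0n R n) (nrm_ge0 (y n)).
  move=> /le_lt_trans /[apply]; rewrite pmulr_lgt0// mulr_gt0//.
pose s n x : R := if 0 <= rdot x (f (y n)) then 1 else -1.
pose step n x := x + (s n x * (w n.+1 / nrm (f (y n))))%:C%C *: f (y n).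
pose u := fix u n := if n is m.+1 then step m (u m) else 0.
have step_len n x : nrm (step n x - x) = w n.+1.
  rewrite /step addrAC subrr add0r nrmZ normrM [`|_ / _|]gtr0_norm ?divr_gt0//.
  rewrite -mulrA divfK ?gt_eqF// /s.
  case: ifP => _; first by rewrite normr1 mul1r.
  by rewrite normrN1 mul1r.
have step_gain n x : w n.+1 * nrm (f (y n)) <= `|rdot (step n x) (f (y n))|.
  rewrite /step rdotDl rdotZl rdotxx.
  have -> : s n x * (w n.+1 / nrm (f (y n))) * nrm (f (y n)) ^+ 2 =
      s n x * (w n.+1 * nrm (f (y n))).
    by rewrite -!mulrA expr2 mulKf ?gt_eqF.
  have : 0 < w n.+1 * nrm (f (y n)) by rewrite mulr_gt0.
  rewrite /s; case: ifP => [r0 a0|/negbT]; first by rewrite ger0_norm; lra.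
  by rewrite -ltNge => r0 a0; rewrite ltr0_norm; lra.
(* Each step of length [w n.+1] equals [2^-1 * (w n - w n.+1)], so the bound
   telescopes. *)
have udist n m : (n <= m)%N -> nrm (u m - u n) <= 2^-1 * (w n - w m).
  elim: m => [|m IH].
    by rewrite leqn0 => /eqP->; rewrite !subrr mulr0 nrm0.
  rewrite leq_eqVlt ltnS => /orP[/eqP->|/IH nm].
    by rewrite !subrr mulr0 nrm0.
  have -> : u m.+1 - u n = (step m (u m) - u m) + (u m - u n) by rewrite subrKA.
  by apply: le_trans (nrmD _ _) _; rewrite step_len wS; lra.
have e0 : 2^-1 * w n @[n --> \oo] --> 0.
  rewrite -(mulr0 2^-1); apply: cvgM; first exact: cvg_cst.
  by apply: cvg_expr; rewrite ger0_norm ?invr_ge0// invf_lt1// ltr1n.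
have ue n m : (n <= m)%N -> nrm (u m - u n) <= 2^-1 * w n.
  by move=> /udist; have := w0 m; lra.
have [x xu _] := cauchy_rate e0 ue.
have nfx n : 1 * n%:R <= nrm (f x).
  have low : w n.+1 * nrm (f (y n)) <=
      `|rdot x (f (y n))| + `|rdot (u n.+1 - x) (f (y n))|.
    apply: le_trans (step_gain n (u n)) _; rewrite -[step n (u n)]/(u n.+1).
    by rewrite -{1}[u n.+1](subrK x) rdotDl addrC ler_normD.
  have := abs_rdot_le (u n.+1 - x) (f (y n)).
  have : nrm (u n.+1 - x) * nrm (f (y n)) <= 2^-1 * w n.+1 * nrm (f (y n)).
    by rewrite ler_pM2r// -nrmN opprB.
  have := abs_rdot_le (f x) (y n).
  have -> : rdot (f x) (y n) = rdot x (f (y n)) by rewrite /rdot f_sym.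
  have := yP n => ? ? ? ?.
  have yx : n%:R * nrm (y n) < nrm (f x) * nrm (y n) by lra.
  rewrite mul1r; apply: ltW; rewrite -(ltr_pM2r (_ : 0 < nrm (y n)))//.
  rewrite nrm_gt0; apply: contraTneq yx => ->.
  by rewrite nrm0 !mulr0 ltxx.
have := natmul_bounded_le0 nfx; lra.
Qed.

Lemma symmetric_bop : exists T : bop H, T =1 f.
Proof.
have [M fM] := symmetric_bounded.
pose F : {linear H -> H} :=
  HB.pack f (GRing.isLinear.Build _ _ _ _ _ symmetric_linear).
have bF : bounded_linear F.
  by exists M%:C%C => x; rewrite !nrmE -rmorphM lecR.
by exists (Bop bF).
Qed.

End HellingerToeplitz.

(** * Moore-Penrose inverses of self-adjoint operators *)

Section MoorePenrose.
Context {R : realType} {H : hilbertType R}.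
Implicit Types A B X Y : bop H.

Lemma is_adjointP A B : is_adjoint A B -> adjoint A = B.
Proof.
move=> AB; apply: (is_adjoint_uniq (T := A)) => //.
by rewrite /adjoint; case: xgetP => [S -> //|/(_ B)].
Qed.

(** The default value of [adjoint] is harmless here: a hermitian [A] whose
adjoint is the default is [bop0] itself, and that operator is symmetric. *)
Lemma hermitian_opP A : hermitian_op A <-> is_adjoint A A.
Proof.
split=> [|/is_adjointP//]; rewrite /hermitian_op /adjoint.
case: xgetP => [S _ /= AS SA|_ <- x y]; first by rewrite SA in AS.
by rewrite /= linear0l linear0r.
Qed.

Lemma bop_eqP A B x : A = B -> A x = B x.
Proof. by move=> ->. Qed.

Lemma self_adjoint_ker2 A x : is_adjoint A A -> A (A x) = 0 -> A x = 0.
Proof.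
move=> symA AAx; apply/eqP; rewrite -normr_eq0 -sqrf_eq0 -inner_norm.
by rewrite symA AAx linear0r.
Qed.

(** The inverse maps [y] to the preimage, within the range of [A], of the
orthogonal projection of [y] on that range.  A first projection gives some [z]
with [A z] equal to the projection of [y]; projecting [z] once more removes its
component in the kernel of [A].  Every equation between vectors of the range of
[A] may be checked after applying [A] twice ([rI]), where the defining property
[A (A (X y)) = A y] applies. *)
Lemma moore_penrose_exists A : is_adjoint A A -> closed_range A ->
  exists X, is_adjoint X X /\ is_moore_penrose A X.
Proof.
move=> symA clA.
have rangeZD c x y : range A x -> range A y -> range A (c *: x + y).
  by move=> [a _ <-] [b _ <-]; exists (c *: a + b) => //; rewrite linearP.
have range0 : range A 0 by exists 0 => //; rewrite linear0.
have proj := orthogonal_projection clA range0 rangeZD.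
have projA y : exists z, A (A z) = A y.
  have [p [z _ <-] orth] := proj y; exists z; apply/eqP.
  rewrite -subr_eq0 -opprB oppr_eq0 -linearB.
  by rewrite -normr_eq0 -sqrf_eq0 -inner_norm symA orth//; exists (A (y - A z)).
have /choice[f fP] y : exists x, A (A x) = A y /\ range A x.
  have [z Az] := projA y; have [w Aw] := projA z.
  by exists (A w); split; [rewrite Aw | exists w].
have fA y : A (A (f y)) = A y by case: (fP y).
have f_sym x y : inner (f x) y = inner x (f y).
  have [_ [a _ fx]] := fP x; have [_ [b _ fy]] := fP y.
  have -> : inner (f x) y = inner (A (f x)) (f y).
    by rewrite -{1}fx symA -fA -symA fx symA.
  by rewrite -[in RHS]fy -symA -[A x]fA [RHS]symA fy.
have [X Xf] := symmetric_bop f_sym.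
have symX : is_adjoint X X by move=> x y; rewrite !Xf.
have AX y : A (A (X y)) = A y by rewrite Xf.
have rX y : range A (X y) by rewrite Xf; case: (fP y).
have rI x y : range A x -> range A y -> A (A x) = A (A y) -> x = y.
  move=> rx ry xy.
  have [w _ Aw] : range A (x - y).
    by rewrite -scaleN1r addrC; exact: rangeZD.
  apply/eqP; rewrite -subr_eq0 -Aw; apply/eqP.
  do 2 apply: (self_adjoint_ker2 symA).
  by rewrite Aw !linearB xy subrr.
have rA y : range A (A y) by exists y.
have XA y : X (A y) = A (X y) by apply: rI => //; rewrite !AX.
exists X; split=> //; split.
- by apply: bopP => y; apply: rI => //; rewrite /= AX.
- by apply: bopP => y /=; apply: rI => //; rewrite !AX.
- by apply/hermitian_opP => x y /=; rewrite symA symX XA.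
- by apply/hermitian_opP => x y /=; rewrite symX symA XA.
Qed.

(** [A X] and [A Y] are orthogonal projections with the same range, hence equal;
[X A] and [Y A] likewise, as they have the same kernel. *)
Lemma moore_penrose_uniq A X Y :
  is_moore_penrose A X -> is_moore_penrose A Y -> X = Y.
Proof.
case=> AXA XAX /hermitian_opP hAX /hermitian_opP hXA.
case=> AYA YAY /hermitian_opP hAY /hermitian_opP hYA.
have aXA x : A (X (A x)) = A x by exact: (bop_eqP x AXA).
have aYA x : A (Y (A x)) = A x by exact: (bop_eqP x AYA).
have sAX u v : inner (A (X u)) v = inner u (A (X v)) := hAX u v.
have sXA u v : inner (X (A u)) v = inner u (X (A v)) := hXA u v.
have sAY u v : inner (A (Y u)) v = inner u (A (Y v)) := hAY u v.
have sYA u v : inner (Y (A u)) v = inner u (Y (A v)) := hYA u v.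
have AXY x : A (X x) = A (Y x).
  by apply: inner_inj => z; rewrite -[in LHS]aYA sAY sAX aXA sAY.
have XYA x : X (A x) = Y (A x).
  by apply: inner_inj => z; rewrite -[A x in LHS]aYA sXA sYA aXA sYA.
by apply: bopP => x; rewrite -XAX -[in RHS]YAY /= XYA AXY.
Qed.

Lemma moore_penrose_sym A X :
  is_moore_penrose A X -> is_moore_penrose X A.
Proof. by case. Qed.

Lemma moore_penroseP A : is_adjoint A A -> closed_range A ->
  is_adjoint (moore_penrose A) (moore_penrose A) /\
  is_moore_penrose A (moore_penrose A).
Proof.
move=> symA /(moore_penrose_exists symA)[X [symX AX]].
rewrite /moore_penrose; case: xgetP => [Y _ /= AY|/(_ X)//].
by rewrite (moore_penrose_uniq AY AX).
Qed.

(** [A X] is self-adjoint, and its adjoint is [X A]. *)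
Lemma moore_penrose_commute A X x :
  is_adjoint A A -> is_adjoint X X -> is_moore_penrose A X ->
  A (X x) = X (A x).
Proof.
move=> symA symX [_ _ /hermitian_opP hAX _].
apply: inner_inj => z; have := hAX x z; rewrite /= => ->.
by rewrite -symA -symX.
Qed.

(** The hypotheses on the four operators are symmetric under the exchange of
[A], [B] with [X], [Y], so this one implication carries both directions.
With [P = A X] and [Q = B Y], the star order gives [A = P B] and [A = B P],
whence [A Q = Q A = A]; from there every product of [Y] with [A] or [X] is that
of [X] with the same operator. *)
Lemma orders_moore_penrose A B X Y :
  is_adjoint A A -> is_adjoint B B -> is_adjoint X X -> is_adjoint Y Y ->
  is_moore_penrose A X -> is_moore_penrose B Y ->
  loewner_le A B /\ star_le A B -> loewner_le X Y /\ star_le X Y.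
Proof.
move=> sA sB sX sY mpA mpB [leAB []].
rewrite !(is_adjointP sA) => AAB ABA.
have AX x := moore_penrose_commute x sA sX mpA.
have BY x := moore_penrose_commute x sB sY mpB.
case: mpA => AXA XAX _ _; case: mpB => BYB YBY _ _.
have {}AXA x : A (X (A x)) = A x by exact: (bop_eqP x AXA).
have {}XAX x : X (A (X x)) = X x by exact: (bop_eqP x XAX).
have {}BYB x : B (Y (B x)) = B x by exact: (bop_eqP x BYB).
have {}YBY x : Y (B (Y x)) = Y x by exact: (bop_eqP x YBY).
have {}AAB x : A (A x) = A (B x) by exact: (bop_eqP x AAB).
have {}ABA x : A (A x) = B (A x) by exact: (bop_eqP x ABA).
have AYB x : A (Y (B x)) = A x by rewrite -[LHS]AXA AX AAB BYB -AAB -AX AXA.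
have ABX x : A x = B (A (X x)) by rewrite -ABA AX AXA.
have YBA x : Y (B (A x)) = A x by rewrite [A x]ABX -BY BYB.
have AYX x : A (Y x) = A (X x).
  by rewrite -[LHS]AXA [LHS]AX AAB BY AYB -AX.
have YA x : Y (A x) = A (X x) by rewrite [A x in LHS]ABX YBA.
have XY x : X (X x) = X (Y x) by rewrite -[RHS]XAX AX AYX XAX.
have YX x : X (X x) = Y (X x) by rewrite -[X x in RHS]XAX -AX YA AX XAX.
split; last by rewrite /star_le (is_adjointP sX); split; apply: bopP.
(* [Y - X = Y (B - A) Y] *)
move=> x; have := leAB (Y x).
by rewrite -sY /= linearB /= YBY AYX YA AX XAX.
Qed.

End MoorePenrose.

Theorem theorem4p6 (R : realType) (H : hilbertType R) (A B : bop H)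
    (hermA : hermitian_op A) (hermB : hermitian_op B)
    (closedA : closed_range A) (closedB : closed_range B) :
  (loewner_le A B /\ star_le A B) <->
  (loewner_le (moore_penrose A) (moore_penrose B) /\
   star_le (moore_penrose A) (moore_penrose B)).
Proof.
have [sA sB] := ((hermitian_opP A).1 hermA, (hermitian_opP B).1 hermB).
have [sX mpX] := moore_penroseP sA closedA.
have [sY mpY] := moore_penroseP sB closedB.
split; first exact: orders_moore_penrose.
by apply: orders_moore_penrose => //; exact: moore_penrose_sym.
Qed.
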